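(* $\pi_{5.3}(\emptyset)=\pi_{5.7}(\emptyset)=\dfrac{20}{27}$.
   Context: A $3$-graph is a pair $G=(V,E)$ with $E$ a set of $3$-element subsets of $V$. For integers $m,k$, $m.k$ denotes the family of all $3$-graphs on $m$ vertices with exactly $k$ edges. For a $3$-graph $G$ on $n\ge m$ vertices, $e_{m.k}(G)$ is the number of $m$-element subsets of $V(G)$ spanning exactly $k$ edges of $G$, and $\pi_{m.k}(\emptyset)=\lim_{n\to\infty}\max\{e_{m.k}(G): |V(G)|=n\}/\binom{n}{m}$ (the limit exists). *)

(* Defs.v *)
From HB Require Import structures.
From mathcomp Require Import all_boot all_order all_algebra.
From mathcomp Require Import all_classical all_reals.
From mathcomp Require Import topology normedtype sequences.

Set Implicit Arguments.
Unset Strict Implicit.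
Unset Printing Implicit Defensive.

Import Order.TTheory GRing.Theory Num.Theory.
Import numFieldNormedType.Exports.

Local Open Scope ring_scope.

(* A 3-graph on the finite vertex type V is given by its edge set. *)
Definition is_3graph (V : finType) (E : {set {set V}}) : bool :=
  [forall e in E, #|e| == 3%N].

Definition spanned_edges (V : finType) (E : {set {set V}}) (S : {set V}) :
    {set {set V}} :=
  [set e in E | e \subset S].

Definition e_mk (m k : nat) (V : finType) (E : {set {set V}}) : nat :=
  #|[set S : {set V} | (#|S| == m) && (#|spanned_edges E S| == k)]|.

(* Every 3-graph with n vertices is isomorphic to one on 'I_n and e_mk is
   isomorphism invariant, so the maximum may be taken over edge sets on 'I_n. *)
Definition max_e_mk (m k n : nat) : nat :=
  \max_(E : {set {set 'I_n}} | is_3graph E) e_mk m k E.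

(* For n < m the denominator vanishes and the ratio is 0 by convention; this
   does not affect the limit. *)
Definition ratio_mk (R : realType) (m k : nat) : R^nat :=
  fun n => (max_e_mk m k n)%:R / ('C(n, m))%:R.

Definition pi_mk (R : realType) (m k : nat) : R := limn (ratio_mk R m k).

(* Main.v *)
Require Import Defs.
From Stdlib Require Import ZArith.
From HB Require Import structures.
From mathcomp Require Import all_boot all_order all_algebra.
From mathcomp Require Import all_classical all_reals.
From mathcomp Require Import topology normedtype sequences.
From mathcomp Require Import ssrZ zify ring lra.

Import Order.TTheory GRing.Theory Num.Theory.
Import numFieldNormedType.Exports.

(* The delimiters Z and N are taken by int and nat. *)
Delimit Scope Z_scope with BZ.
Local Open Scope ring_scope.

(** Complementation exchanges 5.3 and 5.7, so only 5.3 matters.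

    Lower bound: colour the vertices by their residues mod 3 and take as edges
    the triples whose sum is 1 mod 3, i.e. those of colours 001, 112, 220.
    Of the 243 colour patterns of five vertices, 180 span three edges.

    Upper bound: a flag algebra argument.  For four roots x and a function u
    of the link of a vertex in the roots, the square of the sum over d of
    u(link of d) is nonnegative; a positive combination of such squares, summed
    over all roots, is a sum over 6-tuples of vertices.  Adding to it a multiple
    of (density of 5.3) - 20/27 and averaging over the 15 choices of four roots
    among six vertices gives a function of the 3-graph induced by the 6-tuple
    which is nowhere positive.  Sums run over all maps from the six indices
    to the vertices, so there are no error terms.

    The last fact is checked by computation, on six-vertex graphs whose first
    five vertices are in a locally minimal order: exchanging two consecutive
    vertices never decreases the binary code of the induced graph. *)

(** * Binary tables and exhaustive checks over bit strings *)

Inductive btree := Leaf of Z | Node of btree & btree.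

Fixpoint btree_get (t : btree) (s : seq bool) : Z :=
  match t, s with
  | Leaf z, _ => z
  | Node l r, b :: s' => btree_get (if b then r else l) s'
  | Node _ _, [::] => 0%BZ
  end.

(** Tabulating means that the large checks look a weight up, one step per bit, instead of evaluating
    the certificate again. *)
Fixpoint btree_build (n : nat) (f : seq bool -> Z) : btree :=
  if n is m.+1 then
    Node (btree_build m (fun s => f (false :: s)))
         (btree_build m (fun s => f (true :: s)))
  else Leaf (f [::]).

Lemma btree_get_build (n : nat) (f : seq bool -> Z) (s : seq bool) :
  size s = n -> btree_get (btree_build n f) s = f s.
Proof. by elim: n f s => [|n IH] f [|[] s] //= [/IH->]. Qed.

(** Conditionals replace boolean connectives here and in the checks below: call-by-value evaluation
    would compute both operands of [&&]. *)
Fixpoint all_bits (n : nat) (P : seq bool -> bool) : bool :=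
  if n is m.+1 then
    if all_bits m (fun s => P (false :: s))
    then all_bits m (fun s => P (true :: s)) else false
  else P [::].

Lemma all_bitsP (n : nat) (P : seq bool -> bool) :
  all_bits n P -> forall s, size s = n -> P s.
Proof.
elim: n P => [|n IH] P /=; first by move=> P0 [].
case: ifP => // P0 P1 [|[] s] //= [sz_s]; first exact: IH P1 s sz_s.
exact: IH P0 s sz_s.
Qed.

(** * Sum-of-squares certificates and the weights built from them *)

Fixpoint btree_of_seq (n : nat) (s : seq Z) : btree :=
  if n is m.+1 then
    Node (btree_of_seq m (take (2 ^ m) s)) (btree_of_seq m (drop (2 ^ m) s))
  else Leaf (head 0%BZ s).

(* A function of six bits, given by the list of its 64 values in
   lexicographic order. *)
Definition functional (s : seq Z) : seq bool -> Z :=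
  btree_get (btree_of_seq 6 s).

(* The functionals come from a rounded solution of the semidefinite program of
   the flag algebra method.  They are orthogonal to the distribution of links
   in the extremal colouring, and those which are not invariant under the
   symmetries of the type occur with a full orthogonal basis of the irreducible
   representation they generate. *)
Definition cert_no_edge : seq (Z * (seq bool -> Z)) :=
  ([::
   (3105, functional
     [:: -80; -72; -72; -66; -72; -66; -66; 85; -72; -66; -66; -5; 115; 32; 32;
     0; -72; -66; 115; 32; -66; -5; 32; 0; -66; 85; 32; 0; 32; 0; -61; 37;
     -72; 115; -66; 32; -66; 32; -5; 0; -66; 32; 85; 0; 32; -61; 0; 37; -66;
     32; 32; -61; 85; 0; 0; 37; -5; 0; 0; 37; 0; 37; 37; 160]);
   (145935, functional
     [:: 0; -8; -8; -2; -8; -2; -2; 5; -8; -2; -2; -5; 19; 0; 0; 0; -8; -2; 19;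
     0; -2; -5; 0; 0; -2; 5; 0; 0; 0; 0; -13; 5; -8; 19; -2; 0; -2; 0; -5; 0;
     -2; 0; 5; 0; 0; -13; 0; 5; -2; 0; 0; -13; 5; 0; 0; 5; -5; 0; 0; 5; 0; 5;
     5; 0]);
   (26827200, functional
     [:: 0; 0; 0; 0; 0; 0; 0; 0; 0; 0; 0; 0; 0; -1; 0; 0; 0; 0; 0; 1; 0; 0; 0; 0;
     0; 0; 0; 0; 0; 0; 0; 0; 0; 0; 0; 0; 0; 0; 0; 0; 0; 0; 0; 0; 1; 0; 0; 0;
     0; 0; -1; 0; 0; 0; 0; 0; 0; 0; 0; 0; 0; 0; 0; 0]);
   (26827200, functional
     [:: 0; 0; 0; 0; 0; 0; 0; 0; 0; 0; 0; 0; 0; 0; 0; 0; 0; 0; 0; 0; 0; 0; -1; 0;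
     0; 0; 1; 0; 0; 0; 0; 0; 0; 0; 0; 0; 0; 1; 0; 0; 0; -1; 0; 0; 0; 0; 0; 0;
     0; 0; 0; 0; 0; 0; 0; 0; 0; 0; 0; 0; 0; 0; 0; 0]);
   (26827200, functional
     [:: 0; 0; 0; 0; 0; 0; 0; 0; 0; 0; 0; 0; 0; 0; 1; 0; 0; 0; 0; 0; 0; 0; 0; 0;
     0; 0; 0; 0; -1; 0; 0; 0; 0; 0; 0; -1; 0; 0; 0; 0; 0; 0; 0; 0; 0; 0; 0;
     0; 0; 1; 0; 0; 0; 0; 0; 0; 0; 0; 0; 0; 0; 0; 0; 0])])%BZ.

(** The last six functionals form three orthogonal pairs, each spanning a two-dimensional
    representation of the permutations of the roots in the edge. Squared norms in a pair are as 1 to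
    3 and weights as 3 to 1, so the form is invariant. *)
Definition cert_one_edge : seq (Z * (seq bool -> Z)) :=
  ([::
   (7728, functional
     [:: -1; 5; 5; -25; -18; 5; 5; 10; 5; -25; -25; 44; 45; 0; 0; 4; -18; 5; 45;
     0; -20; 0; -40; 0; 5; 10; 0; 4; -40; 0; -18; 0; -18; 45; 5; 0; -20; -40;
     0; 0; 5; 0; 10; 4; -40; -18; 0; 0; -20; -40; -40; -18; -58; -5; -5; -5;
     0; 0; 0; 0; -5; -5; -5; 0]);
   (1159200, functional
     [:: 2; -1; -1; 5; 0; -1; -1; -2; -1; 5; 5; 2; 0; 0; 0; 1; 0; -1; 0; 0; -5;
     0; -1; 0; -1; -2; 0; 1; -1; 0; 0; 0; 0; 0; -1; 0; -5; -1; 0; 0; -1; 0;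
     -2; 1; -1; 0; 0; 0; -5; -1; -1; 0; -1; 1; 1; 1; 0; 0; 0; 0; 1; 1; 1; 0]);
   (15090300, functional
     [:: 0; 0; 0; 0; 0; 0; 1; 0; 0; 0; 0; 0; 0; 0; 0; 0; 0; 0; 0; 0; 0; 0; 0; 0;
     1; 0; 0; 0; 0; 0; 0; 0; 0; 0; -1; 0; 0; 0; 0; 0; -1; 0; 0; 0; 0; 0; 0;
     0; 0; 0; 0; 0; 0; 0; 0; 0; 0; 0; 0; 0; 0; 0; 0; 0]);
   (5030100, functional
     [:: 0; 0; 0; 0; 0; 2; 1; 0; 0; 0; 0; 0; 0; 0; 0; 0; 0; -2; 0; 0; 0; 0; 0; 0;
     -1; 0; 0; 0; 0; 0; 0; 0; 0; 0; -1; 0; 0; 0; 0; 0; 1; 0; 0; 0; 0; 0; 0;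
     0; 0; 0; 0; 0; 0; 0; 0; 0; 0; 0; 0; 0; 0; 0; 0; 0]);
   (162288, functional
     [:: 0; 0; 0; 0; 1; -1; -2; 0; 0; 0; 0; 0; -5; 0; 0; -1; 1; -1; -5; 0; -10;
     0; -4; 0; -2; 0; 0; -1; -4; 0; -10; 0; -2; 10; 3; 0; 5; 1; 0; 0; 3; 0;
     0; 2; 3; 5; 0; 0; 5; 1; 3; 5; 0; 0; 0; -1; 0; 0; 0; 0; 0; -1; 2; 0]);
   (54096, functional
     [:: 0; 0; 0; 0; 3; -5; -4; 0; 0; 0; 0; 0; -15; 0; 0; -3; -3; 5; 15; 0; 0; 0;
     -2; 0; 4; 0; 0; 3; 2; 0; 0; 0; 0; 0; 1; 0; -15; -7; 0; 0; -1; 0; 0; 0;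
     -5; -15; 0; 0; 15; 7; 5; 15; 0; 0; 0; -3; 0; 0; 0; 0; 0; 3; 0; 0]);
   (287040, functional
     [:: 0; 4; -2; 5; 1; 8; -2; -3; -2; 5; -10; 0; 0; 0; 0; 1; 1; 8; 0; 0; 10; 0;
     -1; 0; -2; -3; 0; 1; -1; 0; 0; 0; -2; 0; -6; 0; -5; -1; 0; 0; -6; 0; 6;
     -2; 2; 0; 0; 0; -5; -1; 2; 0; 0; 2; -1; 1; 0; 0; 0; 0; -1; 1; -2; 0]);
   (95680, functional
     [:: 0; 0; 6; 15; 3; 4; 14; -9; -6; -15; 0; 0; 0; 0; 0; 3; -3; -4; 0; 0; 0;
     0; -3; 0; -14; 9; 0; -3; 3; 0; 0; 0; 0; 0; 10; 0; 15; -3; 0; 0; -10; 0;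
     0; 0; 0; 0; 0; 0; -15; 3; 0; 0; 0; 0; 3; 3; 0; 0; 0; 0; -3; -3; 0; 0])])%BZ.

Definition cert_three_edges : seq (Z * (seq bool -> Z)) :=
  ([::
   (13500, functional
     [:: -90; 9; 9; 0; 9; 0; 0; 46; 0; 0; 0; 0; 9; 18; 18; 9; 0; 0; 9; 18; 0; 0;
     18; 9; 27; 9; 0; 9; 0; 9; 18; 27; 0; 9; 0; 18; 0; 18; 0; 9; 27; 0; 9; 9;
     0; 18; 9; 27; 27; 0; 0; 18; 9; 9; 9; 27; 44; 27; 27; 0; 27; 0; 0; 18]);
   (235440, functional
     [:: -10; 1; 1; 0; 1; 0; 0; 0; 0; 0; 0; 0; 1; 2; 2; 1; 0; 0; 1; 2; 0; 0; 2;
     1; 3; 1; 0; 1; 0; 1; 2; 3; 0; 1; 0; 2; 0; 2; 0; 1; 3; 0; 1; 1; 0; 2; 1;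
     3; 3; 0; 0; 2; 1; 1; 1; 3; 10; 3; 3; 0; 3; 0; 0; 2])])%BZ.

(* The link of a vertex d in four roots x0, .., x3 is the list of the bits of
   x0x1d, x0x2d, x0x3d, x1x2d, x1x3d, x2x3d; below is the action on links of
   the exchange of two consecutive roots. *)
Definition link_swap01 (a : seq bool) : seq bool :=
  if a is [:: a01; a02; a03; a12; a13; a23]
  then [:: a01; a12; a13; a02; a03; a23] else a.

Definition link_swap12 (a : seq bool) : seq bool :=
  if a is [:: a01; a02; a03; a12; a13; a23]
  then [:: a02; a01; a03; a12; a23; a13] else a.

Definition link_swap23 (a : seq bool) : seq bool :=
  if a is [:: a01; a02; a03; a12; a13; a23]
  then [:: a01; a03; a02; a13; a12; a23] else a.

(* The bits of t are those of x0x1x2, x0x1x3, x0x2x3, x1x2x3.  The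
   certificates are given for the types 0000, 1000 and 1110, to which the
   roots are relabelled. *)
Definition cert_of_type (t : seq bool) :
    seq (Z * (seq bool -> Z)) * (seq bool -> seq bool) :=
  match t with
  | [:: false; false; false; false] => (cert_no_edge, id)
  | [:: true; false; false; false] => (cert_one_edge, id)
  | [:: false; true; false; false] => (cert_one_edge, link_swap23)
  | [:: false; false; true; false] =>
      (cert_one_edge, fun a => link_swap23 (link_swap12 a))
  | [:: false; false; false; true] =>
      (cert_one_edge, fun a => link_swap23 (link_swap12 (link_swap01 a)))
  | [:: true; true; true; false] => (cert_three_edges, id)
  | [:: true; true; false; true] => (cert_three_edges, link_swap01)
  | [:: true; false; true; true] =>
      (cert_three_edges, fun a => link_swap01 (link_swap12 a))
  | [:: false; true; true; true] =>
      (cert_three_edges, fun a => link_swap01 (link_swap12 (link_swap23 a)))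
  | _ => ([::], id)
  end.

Definition diag_form (c : seq (Z * (seq bool -> Z))) (a b : seq bool) : Z :=
  foldr (fun p z => p.1 * (p.2 a * p.2 b) + z)%BZ 0%BZ c.

Definition type_form (t a b : seq bool) : Z :=
  let c := cert_of_type t in diag_form c.1 (c.2 a) (c.2 b).

Definition three_edges (s : seq bool) : Z :=
  if count id s == 3%N then 1%BZ else 0%BZ.

(* The two constants are 24 * 558900 and (320 / 9) * 558900, where 558900 is the
   common denominator of the weights of the certificates. *)
Definition weight (t a b : seq bool) : Z :=
  (type_form t a b + 13413600 * (three_edges (t ++ a) + three_edges (t ++ b))
   - 19872000)%BZ.

Definition weight16 (s : seq bool) : Z :=
  weight (take 4 s) (take 6 (drop 4 s)) (drop 10 s).

(** * The weight table: its symmetry and the sign of its averages, by computation *)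

Definition weight_table : btree := btree_build 16 weight16.

Definition swap01 (s : seq bool) : seq bool :=
  if s is [:: t012; t013; t023; t123; a01; a02; a03; a12; a13; a23;
             b01; b02; b03; b12; b13; b23]
  then [:: t012; t013; t123; t023; a01; a12; a13; a02; a03; a23;
           b01; b12; b13; b02; b03; b23] else s.

Definition swap12 (s : seq bool) : seq bool :=
  if s is [:: t012; t013; t023; t123; a01; a02; a03; a12; a13; a23;
             b01; b02; b03; b12; b13; b23]
  then [:: t012; t023; t013; t123; a02; a01; a03; a12; a23; a13;
           b02; b01; b03; b12; b23; b13] else s.

Definition swap23 (s : seq bool) : seq bool :=
  if s is [:: t012; t013; t023; t123; a01; a02; a03; a12; a13; a23;
             b01; b02; b03; b12; b13; b23]
  then [:: t013; t012; t023; t123; a01; a03; a02; a13; a12; a23;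
           b01; b03; b02; b13; b12; b23] else s.

Definition table_symmetric (tab : btree) : bool :=
  all_bits 16 (fun s =>
    let w := btree_get tab s in
    if Z.eqb w (btree_get tab (swap01 s)) then
      if Z.eqb w (btree_get tab (swap12 s)) then
        Z.eqb w (btree_get tab (swap23 s))
      else false
    else false).

(** The relabelling in [cert_of_type] picks one of several permutations to the standard type;
    invariance of the certificates makes the choice harmless, and the weight does not depend on the
    order of the roots. *)
Lemma weight_table_symmetric : table_symmetric weight_table.
Proof. by vm_compute. Qed.

(* The sum of the weights over the 15 ways of choosing four roots out of six
   vertices; the bits of c are those of the triples of the vertices 0, .., 4
   and the bits of l those of the triples containing the vertex 5, both in
   lexicographic order. *)
Definition total_weight (tab : btree) (c l : seq bool) : Z :=
  match c, l with
  | [:: e012; e013; e014; e023; e024; e034; e123; e124; e134; e234],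
    [:: e015; e025; e035; e045; e125; e135; e145; e235; e245; e345] =>
    (btree_get tab [:: e012; e013; e023; e123; e014; e024; e034; e124; e134;
       e234; e015; e025; e035; e125; e135; e235] +
     btree_get tab [:: e012; e014; e024; e124; e013; e023; e034; e123; e134;
       e234; e015; e025; e045; e125; e145; e245] +
     btree_get tab [:: e012; e015; e025; e125; e013; e023; e035; e123; e135;
       e235; e014; e024; e045; e124; e145; e245] +
     btree_get tab [:: e013; e014; e034; e134; e012; e023; e024; e123; e124;
       e234; e015; e035; e045; e135; e145; e345] +
     btree_get tab [:: e013; e015; e035; e135; e012; e023; e025; e123; e125;
       e235; e014; e034; e045; e134; e145; e345] +
     btree_get tab [:: e014; e015; e045; e145; e012; e024; e025; e124; e125;
       e245; e013; e034; e035; e134; e135; e345] +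
     btree_get tab [:: e023; e024; e034; e234; e012; e013; e014; e123; e124;
       e134; e025; e035; e045; e235; e245; e345] +
     btree_get tab [:: e023; e025; e035; e235; e012; e013; e015; e123; e125;
       e135; e024; e034; e045; e234; e245; e345] +
     btree_get tab [:: e024; e025; e045; e245; e012; e014; e015; e124; e125;
       e145; e023; e034; e035; e234; e235; e345] +
     btree_get tab [:: e034; e035; e045; e345; e013; e014; e015; e134; e135;
       e145; e023; e024; e025; e234; e235; e245] +
     btree_get tab [:: e123; e124; e134; e234; e012; e013; e014; e023; e024;
       e034; e125; e135; e145; e235; e245; e345] +
     btree_get tab [:: e123; e125; e135; e235; e012; e013; e015; e023; e025;
       e035; e124; e134; e145; e234; e245; e345] +
     btree_get tab [:: e124; e125; e145; e245; e012; e014; e015; e024; e025;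
       e045; e123; e134; e135; e234; e235; e345] +
     btree_get tab [:: e134; e135; e145; e345; e013; e014; e015; e034; e035;
       e045; e123; e124; e125; e234; e235; e245] +
     btree_get tab [:: e234; e235; e245; e345; e023; e024; e025; e034; e035;
       e045; e123; e124; e125; e134; e135; e145])%BZ
  | _, _ => 0%BZ
  end.

(** The first bit is the least significant one. The code serves only as a measure for the descent in
    [six_weight_le0]. *)
Definition code (s : seq bool) : N :=
  foldr (fun (b : bool) n => if b then N.succ_double n else N.double n) 0%num s.

Definition code_swap01 (s : seq bool) : seq bool :=
  if s is [:: e012; e013; e014; e023; e024; e034; e123; e124; e134; e234]
  then [:: e012; e013; e014; e123; e124; e134; e023; e024; e034; e234]
  else s.

Definition code_swap12 (s : seq bool) : seq bool :=
  if s is [:: e012; e013; e014; e023; e024; e034; e123; e124; e134; e234]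
  then [:: e012; e023; e024; e013; e014; e034; e123; e124; e234; e134]
  else s.

Definition code_swap23 (s : seq bool) : seq bool :=
  if s is [:: e012; e013; e014; e023; e024; e034; e123; e124; e134; e234]
  then [:: e013; e012; e014; e023; e034; e024; e123; e134; e124; e234]
  else s.

Definition code_swap34 (s : seq bool) : seq bool :=
  if s is [:: e012; e013; e014; e023; e024; e034; e123; e124; e134; e234]
  then [:: e012; e014; e013; e024; e023; e034; e124; e123; e134; e234]
  else s.

Definition code_decreases (s : seq bool) : bool :=
  let n := code s in
  if N.ltb (code (code_swap01 s)) n then true else
  if N.ltb (code (code_swap12 s)) n then true else
  if N.ltb (code (code_swap23 s)) n then true else
  N.ltb (code (code_swap34 s)) n.

(** Discarding a five-vertex graph before the loop over the links of the sixth vertex avoids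
    visiting all 2^20 labelled graphs. *)
Definition minimal_codes_checked (tab : btree) : bool :=
  all_bits 10 (fun s =>
    if code_decreases s then true else
    all_bits 10 (fun l => Z.leb (total_weight tab s l) 0)).

Lemma weight_table_minimal_codes : minimal_codes_checked weight_table.
Proof. by vm_compute. Qed.

(** * Weights of vertex tuples and their symmetries *)

Lemma weight_tableE (s : seq bool) :
  size s = 16%N -> btree_get weight_table s = weight16 s.
Proof. exact: btree_get_build. Qed.

Lemma table_symmetricP (tab : btree) : table_symmetric tab ->
  forall s, size s = 16%N ->
  [/\ btree_get tab s = btree_get tab (swap01 s),
      btree_get tab s = btree_get tab (swap12 s)
    & btree_get tab s = btree_get tab (swap23 s)].
Proof.
rewrite /table_symmetric => tab_sym s sz_s.
move: (all_bitsP _ _ tab_sym s sz_s) => {tab_sym}; cbv beta zeta.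
by do 2![case: Z.eqb_spec => // ?] => /Z.eqb_eq.
Qed.

Lemma weight16_swap (s : seq bool) : size s = 16%N ->
  [/\ weight16 s = weight16 (swap01 s), weight16 s = weight16 (swap12 s)
    & weight16 s = weight16 (swap23 s)].
Proof.
move=> sz_s; have := table_symmetricP _ weight_table_symmetric s sz_s.
have sz01 : size (swap01 s) = 16%N by move: s sz_s; do 17![case=> //= ?].
have sz12 : size (swap12 s) = 16%N by move: s sz_s {sz01}; do 17![case=> //= ?].
have sz23 : size (swap23 s) = 16%N
  by move: s sz_s {sz01 sz12}; do 17![case=> //= ?].
by rewrite !weight_tableE.
Qed.

(** Vertices may coincide: the values on degenerate triples are just further bits, and the checks
    range over all bit strings. This is what allows sums over all maps. *)
Definition symmetric3 (V : Type) (e : V -> V -> V -> bool) : Prop :=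
  (forall x y z, e x y z = e y x z) /\ (forall x y z, e x y z = e x z y).

Definition root_type (V : Type) (e : V -> V -> V -> bool) (x y z u : V) :
    seq bool :=
  [:: e x y z; e x y u; e x z u; e y z u].

Definition link (V : Type) (e : V -> V -> V -> bool) (x y z u d : V) :
    seq bool :=
  [:: e x y d; e x z d; e x u d; e y z d; e y u d; e z u d].

Definition root_weight (V : Type) (e : V -> V -> V -> bool)
    (x y z u d f : V) : Z :=
  weight (root_type V e x y z u) (link V e x y z u d) (link V e x y z u f).

Lemma root_weight_swap01 (V : Type) (e : V -> V -> V -> bool)
    (x y z u d f : V) : symmetric3 V e ->
  root_weight V e x y z u d f = root_weight V e y x z u d f.
Proof.
case=> eC eR; have [W _ _] := weight16_swap
  (root_type V e x y z u ++ link V e x y z u d ++ link V e x y z u f) erefl.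
by apply: (etrans W); rewrite /root_weight /root_type /link !(eC y x).
Qed.

Lemma root_weight_swap12 (V : Type) (e : V -> V -> V -> bool)
    (x y z u d f : V) : symmetric3 V e ->
  root_weight V e x y z u d f = root_weight V e x z y u d f.
Proof.
case=> eC eR; have [_ W _] := weight16_swap
  (root_type V e x y z u ++ link V e x y z u d ++ link V e x y z u f) erefl.
apply: (etrans W).
by rewrite /root_weight /root_type /link !(eC z y) (eR x z y).
Qed.

Lemma root_weight_swap23 (V : Type) (e : V -> V -> V -> bool)
    (x y z u d f : V) : symmetric3 V e ->
  root_weight V e x y z u d f = root_weight V e x y u z d f.
Proof.
case=> eC eR; have [_ _ W] := weight16_swap
  (root_type V e x y z u ++ link V e x y z u d ++ link V e x y z u f) erefl.
apply: (etrans W); rewrite /root_weight /root_type /link !(eC u z).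
by rewrite (eR x u z) (eR y u z).
Qed.

Lemma diag_formC (c : seq (Z * (seq bool -> Z))) (a b : seq bool) :
  diag_form c a b = diag_form c b a.
Proof. by elim: c => //= p c ->; congr (_ * _ + _)%BZ; exact: Z.mul_comm. Qed.

Lemma root_weight_swap45 (V : Type) (e : V -> V -> V -> bool)
    (x y z u d f : V) :
  root_weight V e x y z u d f = root_weight V e x y z u f d.
Proof.
rewrite /root_weight /weight /type_form diag_formC.
by congr (_ + _ * _ - _)%BZ; exact: Z.add_comm.
Qed.

Definition six_weight (V : Type) (e : V -> V -> V -> bool)
    (x0 x1 x2 x3 x4 x5 : V) : Z :=
  (root_weight V e x0 x1 x2 x3 x4 x5 +
   root_weight V e x0 x1 x2 x4 x3 x5 +
   root_weight V e x0 x1 x2 x5 x3 x4 +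
   root_weight V e x0 x1 x3 x4 x2 x5 +
   root_weight V e x0 x1 x3 x5 x2 x4 +
   root_weight V e x0 x1 x4 x5 x2 x3 +
   root_weight V e x0 x2 x3 x4 x1 x5 +
   root_weight V e x0 x2 x3 x5 x1 x4 +
   root_weight V e x0 x2 x4 x5 x1 x3 +
   root_weight V e x0 x3 x4 x5 x1 x2 +
   root_weight V e x1 x2 x3 x4 x0 x5 +
   root_weight V e x1 x2 x3 x5 x0 x4 +
   root_weight V e x1 x2 x4 x5 x0 x3 +
   root_weight V e x1 x3 x4 x5 x0 x2 +
   root_weight V e x2 x3 x4 x5 x0 x1)%BZ.

(** A transposition permutes the fifteen summands, up to exchanges of consecutive roots and of the
    two free vertices. The same holds for the three lemmas that follow. *)
Lemma six_weight_swap01 (V : Type) (e : V -> V -> V -> bool)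
    (x0 x1 x2 x3 x4 x5 : V) : symmetric3 V e ->
  six_weight V e x1 x0 x2 x3 x4 x5 = six_weight V e x0 x1 x2 x3 x4 x5.
Proof.
move=> e_sym; rewrite /six_weight !(root_weight_swap01 _ _ x1 x0 _ _ _ _ e_sym).
rewrite (root_weight_swap45 _ _ _ _ _ _ x1 x0); lia.
Qed.

Lemma six_weight_swap12 (V : Type) (e : V -> V -> V -> bool)
    (x0 x1 x2 x3 x4 x5 : V) : symmetric3 V e ->
  six_weight V e x0 x2 x1 x3 x4 x5 = six_weight V e x0 x1 x2 x3 x4 x5.
Proof.
move=> e_sym; rewrite /six_weight !(root_weight_swap01 _ _ x2 x1 _ _ _ _ e_sym).
rewrite !(root_weight_swap12 _ _ _ x2 x1 _ _ _ e_sym).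
rewrite (root_weight_swap45 _ _ _ _ _ _ x2 x1); lia.
Qed.

Lemma six_weight_swap23 (V : Type) (e : V -> V -> V -> bool)
    (x0 x1 x2 x3 x4 x5 : V) : symmetric3 V e ->
  six_weight V e x0 x1 x3 x2 x4 x5 = six_weight V e x0 x1 x2 x3 x4 x5.
Proof.
move=> e_sym; rewrite /six_weight !(root_weight_swap01 _ _ x3 x2 _ _ _ _ e_sym).
rewrite !(root_weight_swap12 _ _ _ x3 x2 _ _ _ e_sym).
rewrite !(root_weight_swap23 _ _ _ _ x3 x2 _ _ e_sym).
rewrite (root_weight_swap45 _ _ _ _ _ _ x3 x2); lia.
Qed.

Lemma six_weight_swap34 (V : Type) (e : V -> V -> V -> bool)
    (x0 x1 x2 x3 x4 x5 : V) : symmetric3 V e ->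
  six_weight V e x0 x1 x2 x4 x3 x5 = six_weight V e x0 x1 x2 x3 x4 x5.
Proof.
move=> e_sym; rewrite /six_weight !(root_weight_swap12 _ _ _ x4 x3 _ _ _ e_sym).
rewrite !(root_weight_swap23 _ _ _ _ x4 x3 _ _ e_sym).
rewrite (root_weight_swap45 _ _ _ _ _ _ x4 x3); lia.
Qed.

Definition bits5 (V : Type) (e : V -> V -> V -> bool) (x0 x1 x2 x3 x4 : V) :
    seq bool :=
  [:: e x0 x1 x2; e x0 x1 x3; e x0 x1 x4; e x0 x2 x3; e x0 x2 x4; e x0 x3 x4;
      e x1 x2 x3; e x1 x2 x4; e x1 x3 x4; e x2 x3 x4].

Definition link5 (V : Type) (e : V -> V -> V -> bool) (x0 x1 x2 x3 x4 d : V) :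
    seq bool :=
  [:: e x0 x1 d; e x0 x2 d; e x0 x3 d; e x0 x4 d; e x1 x2 d; e x1 x3 d;
      e x1 x4 d; e x2 x3 d; e x2 x4 d; e x3 x4 d].

Lemma six_weightE (V : Type) (e : V -> V -> V -> bool)
    (x0 x1 x2 x3 x4 x5 : V) : symmetric3 V e ->
  six_weight V e x0 x1 x2 x3 x4 x5 =
  total_weight weight_table (bits5 V e x0 x1 x2 x3 x4)
    (link5 V e x0 x1 x2 x3 x4 x5).
Proof.
case=> eC eR; rewrite /total_weight /bits5 /link5 !weight_tableE //.
rewrite /six_weight /root_weight /root_type /link.
(* The arguments of each [e] are sorted by index, the order in which [total_weight] names its
   bits. *)
rewrite !(eR _ x5 x4) !(eR _ x5 x3) !(eR _ x5 x2) !(eR _ x5 x1) !(eR _ x5 x0).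
rewrite !(eR _ x4 x3) !(eR _ x4 x2) !(eR _ x4 x1) !(eR _ x4 x0) !(eR _ x3 x2).
rewrite !(eR _ x3 x1) !(eR _ x3 x0) !(eR _ x2 x1) !(eR _ x2 x0).
rewrite !(eC x4 x3) !(eC x4 x2) !(eC x4 x1) !(eC x4 x0) !(eC x3 x2).
by rewrite !(eC x3 x1) !(eC x3 x0) !(eC x2 x1) !(eC x2 x0) !(eC x1 x0).
Qed.

Lemma minimal_codes_checkedP (tab : btree) : minimal_codes_checked tab ->
  forall s l, size s = 10%N -> size l = 10%N ->
  code_decreases s \/ (total_weight tab s l <= 0)%BZ.
Proof.
rewrite /minimal_codes_checked => tab_ok s l sz_s sz_l.
move: (all_bitsP _ _ tab_ok s sz_s) => {tab_ok}; cbv beta.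
case: (code_decreases s) => [|tab_ok]; first by left.
by right; apply/Z.leb_le; exact: (all_bitsP _ _ tab_ok l sz_l).
Qed.

(** Descent on the code of the first five vertices: an exchange that lowers it preserves
    [six_weight], and when none of the four does, the computed check applies. *)
Lemma six_weight_le0 (V : Type) (e : V -> V -> V -> bool)
    (x0 x1 x2 x3 x4 x5 : V) : symmetric3 V e ->
  (six_weight V e x0 x1 x2 x3 x4 x5 <= 0)%BZ.
Proof.
move=> e_sym; have [eC eR] := e_sym.
have [n] := ubnP (N.to_nat (code (bits5 V e x0 x1 x2 x3 x4))).
elim: n x0 x1 x2 x3 x4 => // n IH x0 x1 x2 x3 x4; rewrite ltnS => le_n.
have descend (s : seq bool) :
    N.ltb (code s) (code (bits5 V e x0 x1 x2 x3 x4)) ->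
    (N.to_nat (code s) < n)%N.
  by move/N.ltb_lt => lt_s; lia.
have [| ] := minimal_codes_checkedP _ weight_table_minimal_codes
  (bits5 V e x0 x1 x2 x3 x4) (link5 V e x0 x1 x2 x3 x4 x5) erefl erefl;
  last by rewrite six_weightE.
have code01 : bits5 V e x1 x0 x2 x3 x4 =
    code_swap01 (bits5 V e x0 x1 x2 x3 x4).
  by rewrite /bits5 !(eC x1 x0).
have code12 : bits5 V e x0 x2 x1 x3 x4 =
    code_swap12 (bits5 V e x0 x1 x2 x3 x4).
  by rewrite /bits5 !(eC x2 x1) !(eR _ x2 x1).
have code23 : bits5 V e x0 x1 x3 x2 x4 =
    code_swap23 (bits5 V e x0 x1 x2 x3 x4).
  by rewrite /bits5 !(eC x3 x2) !(eR _ x3 x2).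
have code34 : bits5 V e x0 x1 x2 x4 x3 =
    code_swap34 (bits5 V e x0 x1 x2 x3 x4).
  by rewrite /bits5 !(eR _ x4 x3).
rewrite /code_decreases -code01 -code12 -code23 -code34.
case: ifP => [/descend/IH | _]; first by rewrite six_weight_swap01.
case: ifP => [/descend/IH | _]; first by rewrite six_weight_swap12.
case: ifP => [/descend/IH | _]; first by rewrite six_weight_swap23.
by move=> /descend/IH; rewrite six_weight_swap34.
Qed.

(** * Averaging over all maps from six indices to the vertices *)

Lemma diag_form_sum_ge0 (I : finType) (g : I -> seq bool)
    (c : seq (Z * (seq bool -> Z))) :
  all (fun p => Z.leb 0 p.1) c ->
  0 <= \sum_i \sum_j diag_form c (g i) (g j) :> Z.
Proof.
elim: c => [|p c IH] /=.
  by move=> _; rewrite big1 // => i _; rewrite big1.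
case/andP=> p_ge0 /IH {}IH.
(* Summed over both links, a term of the certificate becomes its weight times a perfect square. *)
have -> : \sum_i \sum_j (p.1 * (p.2 (g i) * p.2 (g j)) +
      diag_form c (g i) (g j))%BZ =
    p.1 * (\sum_i p.2 (g i)) ^+ 2 + \sum_i \sum_j diag_form c (g i) (g j) :> Z.
  rewrite expr2 mulr_suml mulr_sumr -big_split; apply: eq_bigr => i _.
  by rewrite /= !mulr_sumr -big_split.
rewrite addr_ge0 // mulr_ge0 ?sqr_ge0 //; lia.
Qed.

Lemma cert_of_type_ge0 (t : seq bool) :
  all (fun p => Z.leb 0 p.1) (cert_of_type t).1.
Proof. by case: t => [|[] [|[] [|[] [|[] [|? ?]]]]]. Qed.

Lemma sum_pairs6 (V : finType) (F : V -> V -> V -> V -> V -> V -> Z) :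
  \sum_(p : V * V * V * V * V * V)
     (let: (x0, x1, x2, x3, x4, x5) := p in F x0 x1 x2 x3 x4 x5) =
  \sum_x0 \sum_x1 \sum_x2 \sum_x3 \sum_x4 \sum_x5 F x0 x1 x2 x3 x4 x5.
Proof.
do 5 rewrite pair_bigA /=.
by apply: eq_bigr => -[[[[[x0 x1] x2] x3] x4] x5] _.
Qed.

(** Each of the fifteen summands is [root_weight] composed with a permutation of the coordinates,
    which leaves the sum over all six-tuples unchanged. *)
Lemma sum_six_weight (V : finType) (e : V -> V -> V -> bool) :
  \sum_(p : V * V * V * V * V * V)
     (let: (x0, x1, x2, x3, x4, x5) := p in six_weight V e x0 x1 x2 x3 x4 x5) =
  (\sum_(p : V * V * V * V * V * V)
     (let: (x0, x1, x2, x3, x4, x5) := p in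
      root_weight V e x0 x1 x2 x3 x4 x5)) *+ 15.
Proof.
rewrite /six_weight; move: (root_weight V e) => W.
pose rw (p : V * V * V * V * V * V) :=
  let: (x0, x1, x2, x3, x4, x5) := p in W x0 x1 x2 x3 x4 x5.
have rw_inj (h : V * V * V * V * V * V -> V * V * V * V * V * V) :
    injective h -> \sum_p rw (h p) = \sum_p rw p.
  by move=> h_inj; rewrite [RHS](reindex_inj h_inj).
pose h1 (p : V * V * V * V * V * V) :=
  let: (x0, x1, x2, x3, x4, x5) := p in (x0, x1, x2, x3, x4, x5).
pose h2 (p : V * V * V * V * V * V) :=
  let: (x0, x1, x2, x3, x4, x5) := p in (x0, x1, x2, x4, x3, x5).
pose h3 (p : V * V * V * V * V * V) :=
  let: (x0, x1, x2, x3, x4, x5) := p in (x0, x1, x2, x5, x3, x4).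
pose h4 (p : V * V * V * V * V * V) :=
  let: (x0, x1, x2, x3, x4, x5) := p in (x0, x1, x3, x4, x2, x5).
pose h5 (p : V * V * V * V * V * V) :=
  let: (x0, x1, x2, x3, x4, x5) := p in (x0, x1, x3, x5, x2, x4).
pose h6 (p : V * V * V * V * V * V) :=
  let: (x0, x1, x2, x3, x4, x5) := p in (x0, x1, x4, x5, x2, x3).
pose h7 (p : V * V * V * V * V * V) :=
  let: (x0, x1, x2, x3, x4, x5) := p in (x0, x2, x3, x4, x1, x5).
pose h8 (p : V * V * V * V * V * V) :=
  let: (x0, x1, x2, x3, x4, x5) := p in (x0, x2, x3, x5, x1, x4).
pose h9 (p : V * V * V * V * V * V) :=
  let: (x0, x1, x2, x3, x4, x5) := p in (x0, x2, x4, x5, x1, x3).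
pose h10 (p : V * V * V * V * V * V) :=
  let: (x0, x1, x2, x3, x4, x5) := p in (x0, x3, x4, x5, x1, x2).
pose h11 (p : V * V * V * V * V * V) :=
  let: (x0, x1, x2, x3, x4, x5) := p in (x1, x2, x3, x4, x0, x5).
pose h12 (p : V * V * V * V * V * V) :=
  let: (x0, x1, x2, x3, x4, x5) := p in (x1, x2, x3, x5, x0, x4).
pose h13 (p : V * V * V * V * V * V) :=
  let: (x0, x1, x2, x3, x4, x5) := p in (x1, x2, x4, x5, x0, x3).
pose h14 (p : V * V * V * V * V * V) :=
  let: (x0, x1, x2, x3, x4, x5) := p in (x1, x3, x4, x5, x0, x2).
pose h15 (p : V * V * V * V * V * V) :=
  let: (x0, x1, x2, x3, x4, x5) := p in (x2, x3, x4, x5, x0, x1).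
rewrite (eq_bigr (fun p =>
    rw (h1 p) + rw (h2 p) + rw (h3 p) + rw (h4 p) + rw (h5 p) +
    rw (h6 p) + rw (h7 p) + rw (h8 p) + rw (h9 p) + rw (h10 p) +
    rw (h11 p) + rw (h12 p) + rw (h13 p) + rw (h14 p) + rw (h15 p)));
  last first.
  case=> [[[[[x0 x1] x2] x3] x4] x5] _; rewrite /rw /h1 /h2 /h3 /h4 /h5.
  rewrite /h6 /h7 /h8 /h9 /h10 /h11 /h12 /h13 /h14 /h15; lia.
rewrite !big_split /= !rw_inj; first by rewrite !mulrS mulr0n addr0 !addrA.
all: by move=> [[[[[? ?] ?] ?] ?] ?] [[[[[? ?] ?] ?] ?] ?] [*]; subst.
Qed.

Lemma sum_const_card (V : finType) (a : Z) : \sum_(x : V) a = a * #|V|%:R.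
Proof. by rewrite sumr_const mulr_natr. Qed.

Lemma three_edges_natr (s : seq bool) : three_edges s = (count id s == 3)%:R.
Proof. by rewrite /three_edges; case: eqP. Qed.

(* The nonnegative part of the weights is a sum of squares once the two free
   vertices are summed over. *)
Lemma sum_root_weight_ge (V : finType) (e : V -> V -> V -> bool)
    (x y z u : V) :
  26827200%BZ * #|V|%:R *
    (\sum_d (count id (root_type V e x y z u ++ link V e x y z u d) == 3)%:R)
    - 19872000%BZ * #|V|%:R ^+ 2
  <= \sum_d \sum_f root_weight V e x y z u d f :> Z.
Proof.
pose c d : Z :=
  (count id (root_type V e x y z u ++ link V e x y z u d) == 3)%:R.
have -> : \sum_d \sum_f root_weight V e x y z u d f =
    \sum_d \sum_f type_form (root_type V e x y z u) (link V e x y z u d)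
      (link V e x y z u f) +
    \sum_d \sum_f (13413600%BZ * (c d + c f) - 19872000%BZ) :> Z.
  rewrite -big_split; apply: eq_bigr => d _; rewrite -big_split.
  apply: eq_bigr => f _; rewrite /= /root_weight /weight !three_edges_natr.
  by rewrite -/(c d) -/(c f) addrA.
have -> : \sum_d \sum_f (13413600%BZ * (c d + c f) - 19872000%BZ) =
    (26827200%BZ * #|V|%:R) * (\sum_d c d) - 19872000%BZ * #|V|%:R ^+ 2 :> Z.
  transitivity (\sum_d (13413600%BZ * (c d * #|V|%:R + \sum_f c f)
      - 19872000%BZ * #|V|%:R)).
    apply: eq_bigr => d _.
    by rewrite sumrB -mulr_sumr big_split /= !sum_const_card.
  rewrite sumrB -mulr_sumr big_split /= !sum_const_card -mulr_suml.
  move: (\sum_d c d) (#|V|%:R : Z) => S n.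
  (* The two free vertices contribute equally, hence the doubling; it is exposed before the
     constants become variables for [ring]. *)
  rewrite (_ : 26827200%BZ = 13413600%BZ *+ 2) //.
  by move: 13413600%BZ 19872000%BZ => a b; ring.
rewrite lerDr.
exact: (diag_form_sum_ge0 _ _ _ (cert_of_type_ge0 _)).
Qed.

Lemma three_edge_density (V : finType) (e : V -> V -> V -> bool) :
  symmetric3 V e ->
  (27 * \sum_x \sum_y \sum_z \sum_u \sum_d
     (count id (root_type V e x y z u ++ link V e x y z u d) == 3)
   <= 20 * #|V| ^ 5)%N.
Proof.
move=> e_sym; set N5 := (\sum_x _)%N.
(* The empty case is set apart because a factor [#|V|] is cancelled at the end. *)
have [V0|V_gt0] := posnP #|V|.
  by rewrite /N5 big1 // => x; have := fintype0 x V0.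
have six_le0 : \sum_(p : V * V * V * V * V * V)
    (let: (x0, x1, x2, x3, x4, x5) := p in
     six_weight V e x0 x1 x2 x3 x4 x5) <= 0 :> Z.
  rewrite sumr_le0 // => -[[[[[x0 x1] x2] x3] x4] x5] _.
  by have := six_weight_le0 V e x0 x1 x2 x3 x4 x5 e_sym; lia.
have {six_le0} : \sum_x \sum_y \sum_z \sum_u \sum_d \sum_f
    root_weight V e x y z u d f <= 0 :> Z.
  by move: six_le0; rewrite sum_six_weight pmulrn_lle0 // sum_pairs6.
have : \sum_x \sum_y \sum_z \sum_u (26827200%BZ * #|V|%:R *
    (\sum_d (count id (root_type V e x y z u ++ link V e x y z u d) == 3)%:R)
    - 19872000%BZ * #|V|%:R ^+ 2)
  <= \sum_x \sum_y \sum_z \sum_u \sum_d \sum_f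
    root_weight V e x y z u d f :> Z.
  do 4![apply: ler_sum => ? _]; exact: sum_root_weight_ge.
set W := (X in _ <= X -> _).
have -> : \sum_x \sum_y \sum_z \sum_u (26827200%BZ * #|V|%:R *
    (\sum_d (count id (root_type V e x y z u ++ link V e x y z u d) == 3)%:R)
    - 19872000%BZ * #|V|%:R ^+ 2)
  = 26827200%BZ * #|V|%:R * N5%:R - 19872000%BZ * #|V|%:R ^+ 6 :> Z.
  rewrite natr_sum mulr_sumr.
  transitivity (\sum_x \sum_y \sum_z
    (26827200%BZ * #|V|%:R * (\sum_u \sum_d
      (count id (root_type V e x y z u ++ link V e x y z u d) == 3))%:R
      - 19872000%BZ * #|V|%:R ^+ 3) : Z).
    do 3![apply: eq_bigr => ? _]; rewrite sumrB sum_const_card.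
    rewrite -mulr_sumr natr_sum; congr (_ * _ - _); last first.
      by rewrite -mulrA -exprSr.
    by apply: eq_bigr => u _; rewrite natr_sum.
  transitivity (\sum_x \sum_y
    (26827200%BZ * #|V|%:R * (\sum_z \sum_u \sum_d
      (count id (root_type V e x y z u ++ link V e x y z u d) == 3))%:R
      - 19872000%BZ * #|V|%:R ^+ 4) : Z).
    do 2![apply: eq_bigr => ? _]; rewrite sumrB sum_const_card.
    rewrite -mulr_sumr natr_sum; congr (_ * _ - _).
    by rewrite -mulrA -exprSr.
  transitivity (\sum_x
    (26827200%BZ * #|V|%:R * (\sum_y \sum_z \sum_u \sum_d
      (count id (root_type V e x y z u ++ link V e x y z u d) == 3))%:R
      - 19872000%BZ * #|V|%:R ^+ 5) : Z).
    apply: eq_bigr => ? _; rewrite sumrB sum_const_card.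
    rewrite -mulr_sumr natr_sum; congr (_ * _ - _).
    by rewrite -mulrA -exprSr.
  rewrite sumrB sum_const_card; congr (_ - _).
  by rewrite -mulrA -exprSr.
move=> le_W W_le0; have {W le_W W_le0} := le_trans le_W W_le0.
rewrite (_ : _ - _ = #|V|%:R *
    (26827200%BZ * N5%:R - 19872000%BZ * #|V|%:R ^+ 5)); last first.
  by move: 26827200%BZ 19872000%BZ => a b; ring.
rewrite pmulr_rle0 ?ltr0n //.
(* The constants are 27 and 20 times 993600. *)
by rewrite -natrX; lia.
Qed.

(** * From counts of vertex sets to sums over tuples *)

Lemma sum_tupleS (V : finType) (n : nat) (F : n.+1.-tuple V -> nat) :
  (\sum_t F t = \sum_x \sum_(t : n.-tuple V) F [tuple of x :: t])%N.
Proof.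
rewrite pair_bigA.
rewrite (reindex (fun p : V * n.-tuple V => [tuple of p.1 :: p.2])) //.
exists (fun t => (thead t, [tuple of behead t])) => [[x t] _ | t _] /=.
  by congr (_, _); apply: val_inj.
by rewrite [RHS]tuple_eta.
Qed.

Lemma sum_tuple0 (V : finType) (F : 0.-tuple V -> nat) :
  (\sum_t F t = F [tuple])%N.
Proof. by rewrite (big_pred1 [tuple]) // => t; apply/esym/eqP/tuple0. Qed.

Lemma sum_nat_of_bool (T : finType) (P : pred T) : (\sum_x P x = #|P|)%N.
Proof.
rewrite -sum1_card [RHS]big_mkcond; apply: eq_bigr => x _.
by rewrite unfold_in; case: (P x).
Qed.

(** Every [k]-element set is enumerated by exactly [k]! injective tuples. It serves for edges with
    [k] equal to 3 and for vertex sets with [k] equal to 5. *)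
Lemma card_ordered_sets (V : finType) (k : nat) (P : {set {set V}}) :
  (forall A, A \in P -> #|A| = k) ->
  (\sum_(t : k.-tuple V) (uniq t && ([set x in t] \in P)) = #|P| * k`!)%N.
Proof.
move=> P_k.
transitivity (\sum_(A in P) \sum_(t : k.-tuple V)
    (uniq t && ([set x in t] == A)))%N.
  rewrite exchange_big /=; apply: eq_bigr => t _.
  case: (uniq t) => /=; last by rewrite big1.
  case: (boolP (_ \in P)) => Pt; last first.
    by rewrite big1 // => A PA; case: eqP => // tA; rewrite tA PA in Pt.
  rewrite (bigD1 [set x in t]) //= eqxx big1 // => A /andP[_].
  by rewrite eq_sym; case: eqP.
rewrite -sum_nat_const; apply: eq_bigr => A /P_k A_k.
rewrite -ffactnn.
have <- : #|[set t : k.-tuple V | all (mem A) t & uniq t]| = (k ^_ k)%N.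
  by rewrite card_uniq_tuples; congr (_ ^_ _)%N; rewrite -[RHS]A_k.
rewrite sum_nat_of_bool.
apply: eq_card => t; rewrite !inE unfold_in andbC.
case t_uniq: (uniq t); rewrite ?andbF ?andbT //.
apply/eqP/allP => [<- x tx | tA]; first by rewrite /= inE.
apply/eqP; rewrite eqEcard A_k cardsE (card_uniqP t_uniq) size_tuple leqnn.
by rewrite andbT; apply/fintype.subsetP => x; rewrite inE; exact: tA.
Qed.

Definition edge (V : finType) (E : {set {set V}}) (x y z : V) : bool :=
  [set x; y; z] \in E.

Lemma edge_symmetric3 (V : finType) (E : {set {set V}}) :
  symmetric3 V (edge V E).
Proof.
split=> x y z; rewrite /edge.
  by rewrite (_ : [set x; y; z] = [set y; x; z]) // [[set x; y]]finset.setUC.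
by rewrite -finset.setUA [[set y] :|: _]finset.setUC finset.setUA.
Qed.

Lemma edge_uniq (V : finType) (E : {set {set V}}) (x y z : V) :
  is_3graph E -> edge V E x y z -> uniq [:: x; y; z].
Proof.
move=> /forall_inP E3 /E3; have -> : [set x; y; z] = [set u in [:: x; y; z]].
  by apply/setP => u; rewrite !inE orbA.
by rewrite cardsE => /eqP xyz3; apply/card_uniqP.
Qed.

Lemma sum_edges (V : finType) (E : {set {set V}}) (S : {set V}) :
  is_3graph E ->
  (\sum_(x in S) \sum_(y in S) \sum_(z in S) edge V E x y z =
   #|spanned_edges E S| * 6)%N.
Proof.
move=> E3; have -> : 6%N = 3`! by [].
rewrite -(@card_ordered_sets _ 3); last first.
  by move=> A; rewrite inE => /andP[/(forall_inP E3)/eqP].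
rewrite !sum_tupleS big_mkcond; apply: eq_bigr => x _.
rewrite sum_tupleS; case: ifPn => Sx; last first.
  rewrite big1 // => y _; rewrite sum_tupleS big1 // => z _.
  rewrite sum_tuple0; case: andP => // -[_].
  rewrite inE => /andP[_ /fintype.subsetP/(_ x)]; rewrite !inE eqxx => /(_ isT).
  by rewrite (negPf Sx).
rewrite big_mkcond; apply: eq_bigr => y _.
rewrite sum_tupleS; case: ifPn => Sy; last first.
  rewrite big1 // => z _; rewrite sum_tuple0; case: andP => // -[_].
  rewrite inE => /andP[_ /fintype.subsetP/(_ y)].
  rewrite !inE eqxx orbT => /(_ isT).
  by rewrite (negPf Sy).
rewrite big_mkcond; apply: eq_bigr => z _; rewrite sum_tuple0.
have -> : [set u in [tuple of x :: [tuple of y :: [tuple of z :: [tuple]]]]] =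
    [set x; y; z] by apply/setP => u; rewrite !inE orbA.
rewrite inE -/(edge V E x y z).
have -> : ([set x; y; z] \subset S) = (z \in S).
  by rewrite !finset.subUset !finset.sub1set Sx Sy.
case: (boolP (edge V E x y z)) => [/edge_uniq -> //|_];
  by rewrite ?andbF; case: (z \in S).
Qed.

Definition triple_bits (V : finType) (E : {set {set V}})
    (x0 x1 x2 x3 x4 : V) : seq bool :=
  root_type V (edge V E) x0 x1 x2 x3 ++ link V (edge V E) x0 x1 x2 x3 x4.

(** By [sum_edges], six times the left side is a sum over the 125 ordered triples from the five
    vertices. Degenerate triples vanish and each of the ten others occurs in its six orders. *)
Lemma card_spanned_edges (V : finType) (E : {set {set V}})
    (x0 x1 x2 x3 x4 : V) :
  is_3graph E -> uniq [:: x0; x1; x2; x3; x4] ->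
  #|spanned_edges E [set x in [:: x0; x1; x2; x3; x4]]| =
  count id (triple_bits V E x0 x1 x2 x3 x4).
Proof.
move=> E3 x_uniq; have := sum_edges V E [set x in [:: x0; x1; x2; x3; x4]] E3.
set n := #|spanned_edges E _|.
have sumS (F : V -> nat) :
    (\sum_(x in [set x in [:: x0; x1; x2; x3; x4]]) F x =
     F x0 + F x1 + F x2 + F x3 + F x4)%N.
  rewrite (eq_bigl (fun x => x \in [:: x0; x1; x2; x3; x4])).
    by rewrite -big_uniq //= !big_cons big_nil addn0 !addnA.
  by move=> x; rewrite inE.
rewrite !sumS.
have [eC eR] := edge_symmetric3 V E.
have exx x y : edge V E x x y = false.
  by apply/negP => /(edge_uniq _ _ _ _ _ E3) /=; rewrite inE eqxx.
have exyx x y : edge V E x y x = false by rewrite eR exx.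
have eyxx x y : edge V E y x x = false by rewrite eC exyx.
rewrite !exx !exyx !eyxx /triple_bits /root_type /link /=.
rewrite !(eR _ x4 x3) !(eR _ x4 x2) !(eR _ x4 x1) !(eR _ x4 x0) !(eR _ x3 x2).
rewrite !(eR _ x3 x1) !(eR _ x3 x0) !(eR _ x2 x1) !(eR _ x2 x0) !(eR _ x1 x0).
rewrite !(eC x4 x2) !(eC x4 x1) !(eC x4 x0) !(eC x3 x2) !(eC x3 x1) !(eC x3 x0).
rewrite !(eC x2 x1) !(eC x2 x0) !(eC x1 x0) !(eR _ x4 x3) !(eR _ x4 x2).
rewrite !(eR _ x3 x2) ?(eR _ x4 x1) ?(eR _ x3 x1) ?(eR _ x2 x1).
move: (edge V E x0 x1 x2 : nat) (edge V E x0 x1 x3 : nat)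
  (edge V E x0 x1 x4 : nat) (edge V E x0 x2 x3 : nat) (edge V E x0 x2 x4 : nat)
  (edge V E x0 x3 x4 : nat) (edge V E x1 x2 x3 : nat) (edge V E x1 x2 x4 : nat)
  (edge V E x1 x3 x4 : nat) (edge V E x2 x3 x4 : nat) => *; lia.
Qed.

Lemma e_mk_ordered (V : finType) (E : {set {set V}}) (k : nat) :
  is_3graph E ->
  (e_mk 5 k E * 120 = \sum_x0 \sum_x1 \sum_x2 \sum_x3 \sum_x4
     (uniq [:: x0; x1; x2; x3; x4] &&
      (count id (triple_bits V E x0 x1 x2 x3 x4) == k)))%N.
Proof.
move=> E3; rewrite (_ : 120%N = 5`!) // -card_ordered_sets; last first.
  by move=> A; rewrite inE => /andP[/eqP].
rewrite !sum_tupleS; apply: eq_bigr => x0 _.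
rewrite !sum_tupleS; apply: eq_bigr => x1 _.
rewrite !sum_tupleS; apply: eq_bigr => x2 _.
rewrite !sum_tupleS; apply: eq_bigr => x3 _.
rewrite !sum_tupleS; apply: eq_bigr => x4 _; rewrite sum_tuple0.
set L := [:: x0; x1; x2; x3; x4].
transitivity (uniq L && ([set x in L] \in
    [set S : {set V} | (#|S| == 5) && (#|spanned_edges E S| == k)]) : nat)
  => //.
case: (boolP (uniq L)) => // x_uniq.
by rewrite !andTb inE card_spanned_edges // cardsE (card_uniqP x_uniq).
Qed.

(** Dropping the injectivity condition on 5-tuples only increases the count, which
    [three_edge_density] then bounds. *)
Lemma e_53_upper (V : finType) (E : {set {set V}}) :
  is_3graph E -> (27 * 120 * e_mk 5 3 E <= 20 * #|V| ^ 5)%N.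
Proof.
move=> E3; apply: leq_trans (three_edge_density _ _ (edge_symmetric3 V E)).
rewrite -mulnA leq_mul2l /= mulnC e_mk_ordered //.
by do 5![apply: leq_sum => ? _]; case: (uniq _).
Qed.

(** * The lower bound from the colouring by residues *)

Lemma sum_mod3_ge (f : nat -> nat) (n : nat) :
  (n %/ 3 * (f 0 + f 1 + f 2) <= \sum_(x < n) f (x %% 3))%N.
Proof.
rewrite -(big_mkord xpredT (fun x => f (x %% 3)%N)) {2}(divn_eq n 3).
(* Full periods of residues fill the indices below [n %/ 3 * 3]; the at most two indices left over
   are dropped. *)
rewrite (@big_cat_nat _ _ _ (n %/ 3 * 3)) ?leq_addr //=.
apply: leq_trans (leq_addr _ _).
elim: (n %/ 3)%N => [|q IH]; first by rewrite mul0n.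
rewrite [in X in (_ <= X)%N](mulSn q 3) (addnC 3%N).
rewrite (@big_cat_nat _ _ _ (q * 3)) ?leq_addr //= mulSn addnC leq_add //.
rewrite addn3 big_nat_recr 1?big_nat_recr 1?big_nat_recr; try lia.
rewrite big_geq //= add0n.
have -> : (q * 3 %% 3 = 0)%N by lia.
have -> : ((q * 3).+1 %% 3 = 1)%N by lia.
have -> : ((q * 3).+2 %% 3 = 2)%N by lia.
by [].
Qed.

(* Colouring the vertices by their residues mod 3, the edges are those of the
   three types 001, 112, 220. *)
Definition mod3_graph (n : nat) : {set {set 'I_n}} :=
  [set A : {set 'I_n} | (#|A| == 3) && ((\sum_(x in A) x) %% 3 == 1)%N].

Definition mod3_edge (a b c : nat) : bool := ((a + b + c) %% 3 == 1)%N.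

(** Colours may repeat here, so this is a condition on all 243 patterns; it describes the graph only
    on distinct vertices. *)
Definition mod3_good (c0 c1 c2 c3 c4 : nat) : bool :=
  count id (root_type nat mod3_edge c0 c1 c2 c3 ++
            link nat mod3_edge c0 c1 c2 c3 c4) == 3.

Lemma mod3_graph_3graph (n : nat) : is_3graph (mod3_graph n).
Proof. by apply/forall_inP => A; rewrite inE => /andP[]. Qed.

Lemma edge_mod3_graph (n : nat) (x y z : 'I_n) : uniq [:: x; y; z] ->
  edge _ (mod3_graph n) x y z = mod3_edge (x %% 3) (y %% 3) (z %% 3).
Proof.
move=> xyz; rewrite /edge inE.
have -> : [set x; y; z] = [set u in [:: x; y; z]].
  by apply/setP => u; rewrite !inE orbA.
rewrite cardsE (card_uniqP xyz) /=.
have -> : (\sum_(u in [set u in [:: x; y; z]]) u = x + y + z)%N.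
  rewrite (eq_bigl (fun u => u \in [:: x; y; z])).
    by rewrite -big_uniq //= !big_cons big_nil addn0 addnA.
  by move=> u; rewrite inE.
rewrite /mod3_edge; lia.
Qed.

Lemma triple_bits_mod3_graph (n : nat) (x0 x1 x2 x3 x4 : 'I_n) :
  uniq [:: x0; x1; x2; x3; x4] ->
  (count id (triple_bits _ (mod3_graph n) x0 x1 x2 x3 x4) == 3) =
  mod3_good (x0 %% 3) (x1 %% 3) (x2 %% 3) (x3 %% 3) (x4 %% 3).
Proof.
move=> x_uniq; rewrite /mod3_good /triple_bits /root_type /link.
have := x_uniq; rewrite /= !inE !negb_or -!andbA.
case/and5P=> n01 n02 n03 n04 /and5P[n12 n13 n14 n23 /and3P[n24 n34 _]].
by rewrite !edge_mod3_graph //= !inE !negb_or ?n01 ?n02 ?n03 ?n04 ?n12 ?n13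
  ?n14 ?n23 ?n24 ?n34.
Qed.

Lemma sum_uniq5 (V : finType) :
  (\sum_(x0 : V) \sum_(x1 : V) \sum_(x2 : V) \sum_(x3 : V) \sum_(x4 : V)
     uniq [:: x0; x1; x2; x3; x4] = 'C(#|V|, 5) * 120)%N.
Proof.
rewrite -(card_draws V 5) (_ : 120%N = 5`!) // -card_ordered_sets; last first.
  by move=> A; rewrite inE => /eqP.
rewrite !sum_tupleS; apply: eq_bigr => x0 _.
rewrite !sum_tupleS; apply: eq_bigr => x1 _.
rewrite !sum_tupleS; apply: eq_bigr => x2 _.
rewrite !sum_tupleS; apply: eq_bigr => x3 _.
rewrite !sum_tupleS; apply: eq_bigr => x4 _; rewrite sum_tuple0.
set L := [:: x0; x1; x2; x3; x4].
transitivity (uniq L && ([set x in L] \in [set S : {set V} | #|S| == 5]) : nat)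
  => //.
case: (boolP (uniq L)) => // L_uniq.
by rewrite andTb inE cardsE (card_uniqP L_uniq).
Qed.

Lemma sum_mod3_good_ge (n : nat) :
  (180 * (n %/ 3) ^ 5 <= \sum_(x0 < n) \sum_(x1 < n) \sum_(x2 < n) \sum_(x3 < n)
     \sum_(x4 < n)
       mod3_good (x0 %% 3) (x1 %% 3) (x2 %% 3) (x3 %% 3) (x4 %% 3))%N.
Proof.
pose s (f : nat -> nat) := (f 0 + f 1 + f 2)%N.
set q := (n %/ 3)%N.
have ge4 c0 c1 c2 c3 :
    (q * s (fun c4 => mod3_good c0 c1 c2 c3 c4) <=
     \sum_(x4 < n) mod3_good c0 c1 c2 c3 (x4 %% 3))%N.
  exact: (sum_mod3_ge (fun c4 => mod3_good c0 c1 c2 c3 c4)).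
(* A bound valid for each colour of one vertex gains a factor [q] and a sum over the three colours;
   four uses after [ge4] treat all five vertices. *)
have lift (f : nat -> nat) (g : nat -> nat) (k : nat) :
    (forall c, (k * f c <= g c)%N) ->
    (k * q * s f <= \sum_(x < n) g (x %% 3))%N.
  move=> le_fg; apply: leq_trans (_ : \sum_(x < n) k * f (x %% 3) <= _)%N.
    by rewrite -big_distrr /= -mulnA leq_mul2l sum_mod3_ge orbT.
  by apply: leq_sum.
have ge3 c0 c1 c2 := lift _ _ _ (ge4 c0 c1 c2).
have ge2 c0 c1 := lift _ _ _ (ge3 c0 c1).
have ge1 c0 := lift _ _ _ (ge2 c0).
have := lift _ _ _ ge1.
have -> : s (fun c0 => s (fun c1 => s (fun c2 => s (fun c3 =>
    s (fun c4 => mod3_good c0 c1 c2 c3 c4))))) = 180%N by vm_compute.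
by rewrite mulnC (_ : q * q * q * q * q = q ^ 5)%N // !expnS expn0 muln1 !mulnA.
Qed.

(** Among all [n ^ 5] tuples, those with a good pattern exceed the injective ones with a good
    pattern by at most the number of non-injective tuples. The terms are arranged to avoid
    subtraction. *)
Lemma e_53_lower (n : nat) :
  (180 * (n %/ 3) ^ 5 + 'C(n, 5) * 120 <=
   e_mk 5 3 (mod3_graph n) * 120 + n ^ 5)%N.
Proof.
rewrite e_mk_ordered ?mod3_graph_3graph //.
apply: leq_trans (leq_add (sum_mod3_good_ge n) (leqnn _)) _.
have := sum_uniq5 'I_n; rewrite card_ord => <-.
have -> : (n ^ 5 = \sum_(x0 < n) \sum_(x1 < n) \sum_(x2 < n) \sum_(x3 < n)
    \sum_(x4 < n) 1)%N.
  by rewrite !sum_nat_const !card_ord muln1 !expnS expn0 muln1.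
rewrite -!big_split; apply: leq_sum => x0 _.
rewrite -!big_split; apply: leq_sum => x1 _.
rewrite -!big_split; apply: leq_sum => x2 _.
rewrite -!big_split; apply: leq_sum => x3 _.
rewrite -!big_split; apply: leq_sum => x4 _.
case: (boolP (uniq [:: x0; x1; x2; x3; x4])) => [x_uniq|_].
  by rewrite triple_bits_mod3_graph.
by rewrite /= addn0; case: mod3_good.
Qed.

(** * Complementation *)

Definition complement_3graph (V : finType) (E : {set {set V}}) :
    {set {set V}} :=
  [set A : {set V} | (#|A| == 3) && (A \notin E)].

Lemma complement_is_3graph (V : finType) (E : {set {set V}}) :
  is_3graph (complement_3graph V E).
Proof. by apply/forall_inP => A; rewrite inE => /andP[]. Qed.

(** Membership in [E] splits the ten triples inside [S]. *)
Lemma card_spanned_complement (V : finType) (E : {set {set V}}) (S : {set V}) :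
  is_3graph E -> #|S| = 5 ->
  (#|spanned_edges E S| + #|spanned_edges (complement_3graph V E) S| = 10)%N.
Proof.
move=> /forall_inP E3 S5.
rewrite (_ : 10%N = 'C(#|S|, 3)); last by rewrite S5.
rewrite -cards_draws -(cardsID E [set A : {set V} | A \subset S & #|A| == 3]).
congr (_ + _)%N; apply: eq_card => A; rewrite !inE.
  by case: (boolP (A \in E)) => [/E3 ->|]; rewrite ?andbF ?andbT.
by case: (A \in E); case: (A \subset S); case: (#|A| == 3).
Qed.

Lemma max_e_57 (n : nat) : max_e_mk 5 7 n = max_e_mk 5 3 n.
Proof.
(* Stated for any [k] and [l] with sum 10, so that it yields both inequalities. *)
have le_compl k l : (k + l = 10)%N -> (max_e_mk 5 k n <= max_e_mk 5 l n)%N.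
  move=> kl; apply/bigmax_leqP => E E3.
  apply: leq_trans (leq_bigmax_cond _ (complement_is_3graph _ E)).
  apply/subset_leq_card/fintype.subsetP => S; rewrite !inE.
  case/andP=> /eqP S5 /eqP Sk; rewrite S5 eqxx /=.
  apply/eqP/(@addnI k); rewrite kl -Sk.
  exact: card_spanned_complement.
by apply/eqP; rewrite eqn_leq !le_compl.
Qed.

(** * Bounds on the maximum and passage to the limit *)

Lemma max_e_53_upper (n : nat) :
  (27 * 120 * max_e_mk 5 3 n <= 20 * n ^ 5)%N.
Proof.
rewrite /max_e_mk; elim/big_ind: _ => [|a b la lb|E E3]; first by rewrite muln0.
  by rewrite maxnMr geq_max la lb.
by have := e_53_upper _ _ E3; rewrite card_ord.
Qed.

Lemma max_e_53_lower (n : nat) :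
  (180 * (n %/ 3) ^ 5 + 'C(n, 5) * 120 <= max_e_mk 5 3 n * 120 + n ^ 5)%N.
Proof.
apply: leq_trans (e_53_lower n) _; rewrite leq_add2r leq_mul2r /=.
exact: (leq_bigmax_cond _ (mod3_graph_3graph n)).
Qed.

Lemma ffact5_ge (n : nat) : ((n - 4) ^ 5 <= n ^_ 5)%N.
Proof.
rewrite !ffactnS ffactn0 muln1 !expnS expn0 muln1.
by do 4!(rewrite leq_mul //; first lia); lia.
Qed.

(** Since [u * n] is [n - 4], one quantity tending to 1 controls both errors: [n - 4] bounds the
    factors of the falling factorial and also [3 * (n %/ 3)] from below. *)
Lemma ratio_53_bounds (R : realType) (n : nat) (u : R) :
  (5 <= n)%N -> u = 1 - 4 / n%:R ->
  20 / 27 * u ^+ 5 + u ^+ 5 - 1 <= ratio_mk R 5 3 n <= 20 / 27 / u ^+ 5.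
Proof.
move=> n_ge5 uE; have n3_ge : (n - 4 <= n %/ 3 * 3)%N by lia.
have n_gt0 : 0 < n%:R :> R by rewrite ltr0n; lia.
have n5_gt0 : 0 < n%:R ^+ 5 :> R by rewrite exprn_gt0.
have C_gt0 : 0 < ('C(n, 5))%:R :> R by rewrite ltr0n bin_gt0.
have u_n : u * n%:R = (n - 4)%:R.
  by rewrite uE mulrBl mul1r divfK ?gt_eqF // natrB; last lia.
have u_gt0 : 0 < u.
  by rewrite -(pmulr_lgt0 _ n_gt0) u_n ltr0n; lia.
have u5_gt0 : 0 < u ^+ 5 by rewrite exprn_gt0.
have C_ge : u ^+ 5 * n%:R ^+ 5 <= 120 * ('C(n, 5))%:R.
  rewrite -exprMn u_n -natrX -natrM ler_nat mulnC (_ : 120%N = 5`!) //.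
  by rewrite bin_ffact ffact5_ge.
have C_le : 120 * ('C(n, 5))%:R <= n%:R ^+ 5 :> R.
  rewrite -natrX -natrM ler_nat mulnC (_ : 120%N = 5`!) // bin_ffact.
  by rewrite !ffactnS ffactn0 muln1 !expnS expn0 muln1 !leq_mul //; lia.
have upper : 27 * 120 * (max_e_mk 5 3 n)%:R <= 20 * n%:R ^+ 5 :> R.
  by rewrite -natrX -!natrM ler_nat max_e_53_upper.
have lower : 180 * (n %/ 3)%:R ^+ 5 + 120 * ('C(n, 5))%:R <=
    120 * (max_e_mk 5 3 n)%:R + n%:R ^+ 5 :> R.
  rewrite -!natrX -!natrM -!natrD ler_nat (mulnC 120 'C(n, 5)).
  by rewrite (mulnC 120 (max_e_mk 5 3 n)) max_e_53_lower.
have q_ge : u * n%:R / 3 <= (n %/ 3)%:R.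
  by rewrite u_n ler_pdivrMr // -natrM ler_nat.
(* Here 243 is the fifth power of 3, and 180 / 243 is 20 / 27. *)
have q5_ge : u ^+ 5 * n%:R ^+ 5 <= 243 * (n %/ 3)%:R ^+ 5.
  have : (u * n%:R / 3) ^+ 5 <= (n %/ 3)%:R ^+ 5.
    rewrite lerXn2r ?nnegrE ?ler0n //.
    by rewrite divr_ge0 // mulr_ge0 // ltW.
  by rewrite !exprMn exprVn; lra.
rewrite /ratio_mk; move: lower upper q5_ge C_le C_ge.
move: (max_e_mk 5 3 n)%:R (ler0n R (max_e_mk 5 3 n)) => M M_ge0.
move: ((n %/ 3)%:R ^+ 5) => Q.
move: {q_ge u_n uE u_gt0} (u ^+ 5) u5_gt0 => w w_gt0.
move: (n%:R ^+ 5) n5_gt0 ('C(n, 5))%:R C_gt0 => N N_gt0 C C_gt0.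
move=> lower upper q5_ge C_le C_ge; apply/andP; split; last first.
  rewrite ler_pdivrMr //.
  have : 20 / 27 / w * (w * N) <= 20 / 27 / w * (120 * C).
    by rewrite ler_pM2l // !divr_gt0.
  rewrite mulrA divfK ?gt_eqF //; lra.
rewrite ler_pdivlMr //.
(* Replacing [N] by the smaller [120 * C] requires a nonnegative factor; a negative one makes the
   bound trivial. *)
have [ge0|lt0] := leP 0 (20 / 27 * w + w - 1); last first.
  by apply: le_trans M_ge0; rewrite mulr_le0_ge0 ?ltW.
have : (20 / 27 * w + w - 1) * (120 * C) <= (20 / 27 * w + w - 1) * N.
  by rewrite ler_wpM2l.
lra.
Qed.

Lemma ratio_53_cvg (R : realType) :
  (ratio_mk R 5 3 @ \oo --> (20 / 27 : R))%classic.
Proof.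
pose u (n : nat) : R := 1 - 4 / n%:R.
have u_cvg : (u n @[n --> \oo] --> (1 : R))%classic.
  rewrite -[X in (_ --> X)%classic]subr0; apply: cvgB; first exact: cvg_cst.
  rewrite -(mulr0 4); apply: cvgM; first exact: cvg_cst.
  apply/gtr0_cvgV0.
    by near=> n; rewrite ltr0n; near: n; exact: nbhs_infty_gt.
  exact: cvgr_idn.
have uX_cvg k : (u n ^+ k @[n --> \oo] --> (1 : R))%classic.
  elim: k => [|k IH]; first exact: cvg_cst.
  by under eq_cvg do rewrite exprS; rewrite -(mulr1 1); exact: cvgM.
apply: (@squeeze_cvgr _ _ _ _ (fun n => 20 / 27 * u n ^+ 5 + u n ^+ 5 - 1)
  (fun n => 20 / 27 / u n ^+ 5)).
- by near=> n; apply: ratio_53_bounds => //; near: n; exact: nbhs_infty_ge.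
- rewrite [X in (_ --> X)%classic](_ : _ = 20 / 27 * 1 + 1 - 1); last by lra.
  apply: cvgB; last exact: cvg_cst.
  by apply: cvgD => //; apply: cvgM => //; exact: cvg_cst.
- rewrite [X in (_ --> X)%classic](_ : _ = 20 / 27 / 1); last by lra.
  apply: cvgM; first exact: cvg_cst.
  by apply: cvgV => //; rewrite oner_neq0.
Unshelve. all: by end_near. Qed.

(* limn is a total operator, so convergence of the two defining sequences is
   asserted alongside the values of their limits. *)
Theorem theorem2p30 (R : realType) :
  [/\ cvgn (ratio_mk R 5 3), cvgn (ratio_mk R 5 7),
      pi_mk R 5 3 = pi_mk R 5 7 & pi_mk R 5 7 = 20%:R / 27%:R].
Proof.
have E : ratio_mk R 5 7 = ratio_mk R 5 3.
  by apply/funext => n; rewrite /ratio_mk max_e_57.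
have c53 := ratio_53_cvg R.
have cv : cvgn (ratio_mk R 5 3) by apply/cvg_ex; exists (20 / 27).
by rewrite /pi_mk E; split=> //; exact: cvg_lim.
Qed.
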